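(* For every fixed integer $d\ge 2$, the maximal number of vertices of a central $2$-dimensional section of a $d$-dimensional zonotope with $n$ zones is $\Theta(n^{d-1})$. That is, let $M_d(n)$ denote the maximum, over all $d$-dimensional zonotopes $Z\subset\mathbb{R}^d$ with $n$ zones and all $2$-dimensional affine planes $L$ through the center of $Z$, of the number of vertices of the polygon $Z\cap L$; then $M_d(n)=\Theta(n^{d-1})$ as $n\to\infty$, with implied constants depending only on $d$.
   Context: A zonotope is a Minkowski sum of finitely many line segments. A $d$-dimensional zonotope with $n$ zones is, up to translation, a set of the form $Z=\{\sum_{i=1}^n\lambda_i a_i:\lambda_i\in[-1,1]\}\subset\mathbb{R}^d$, where $a_1,\dots,a_n\in\mathbb{R}^d$ are nonzero vectors that span $\mathbb{R}^d$ and no one of which is a scalar multiple of another. Such a $Z$ is centrally symmetric; in the displayed normalization its center is the origin, so the planes $L$ are the $2$-dimensional linear subspaces. *)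

(* Defs.v *)
From mathcomp Require Import all_boot all_order all_algebra.
From mathcomp Require Import all_classical all_reals all_analysis.

Set Implicit Arguments.
Unset Strict Implicit.
Unset Printing Implicit Defensive.

Import Order.TTheory GRing.Theory Num.Theory.
Import numFieldNormedType.Exports.

Local Open Scope classical_set_scope.
Local Open Scope ring_scope.

Section Zonotopes.
Variables (R : realType) (d : nat).
Implicit Types (Z L P F : set 'rV[R]_d) (c v : 'rV[R]_d).

Definition zone_vectors n (a : 'I_n -> 'rV[R]_d) : Prop :=
  [/\ forall i, a i != 0,
      <<codom a>>%VS = fullv
    & forall i j, i != j -> forall k : R, a i != k *: a j].

Definition zonotope_at n c (a : 'I_n -> 'rV[R]_d) : set 'rV[R]_d :=
  [set x | exists2 l : 'I_n -> R,
     forall i, -1 <= l i <= 1 & x = c + \sum_(i < n) l i *: a i].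

Definition is_zonotope n Z : Prop :=
  exists c (a : 'I_n -> 'rV[R]_d), zone_vectors a /\ Z = zonotope_at c a.

Definition is_center Z c : Prop := forall x, Z x -> Z (c *+ 2 - x).

Definition is_affine_plane L : Prop :=
  exists p (U : {vspace 'rV[R]_d}),
    \dim U = 2%N /\ L = [set p + u | u in [set u | u \in U]].

Definition is_central_section n P : Prop :=
  exists Z c L, [/\ is_zonotope n Z, is_center Z c, is_affine_plane L, L c
                  & P = Z `&` L].

Definition is_face P F : Prop :=
  exists (u : 'cV[R]_d) (b : R),
    (forall x, P x -> (x *m u) 0 0 <= b) /\
    F = P `&` [set x | (x *m u) 0 0 = b].

(* A vertex of a polytope is a zero-dimensional face. *)
Definition vertices P : set 'rV[R]_d := [set v | is_face P [set v]].

(* The second clause also asserts that every central section has finitely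
   many vertices. *)
Definition is_max_section_vertices n (m : nat) : Prop :=
  (exists2 P, is_central_section n P & (vertices P #= `I_m)%card) /\
  (forall P, is_central_section n P -> (vertices P #<= `I_m)%card).

End Zonotopes.

(* The maximum M_d(n), with junk value 0 when there is no maximum; this is the
   case for n < d, as then no d-dimensional zonotope with n zones exists. *)
Definition max_section_vertices (R : realType) (d n : nat) : nat :=
  xget 0%N [set m | is_max_section_vertices R d n m].

(* Main.v *)
Require Import Defs.
From HB Require Import structures.
From mathcomp Require Import all_boot all_order all_algebra.
From mathcomp Require Import all_classical all_reals all_analysis.
From mathcomp Require Import ring lra zify.
Import Order.TTheory GRing.Theory Num.Theory.
Import numFieldNormedType.Exports.
Local Open Scope classical_set_scope.
Local Open Scope ring_scope.

(** Upper bound.  A vertex of [Z `&` L] is [F `&` L] for a face [F] of [Z]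
    (Farkas), [F] is determined by the signs of its normal [w] on the [n]
    generators, and [n] linear forms on a space of dimension [d] have
    [O(n^(d-1))] sign patterns.

    Lower bound.  Let [z] be a piecewise linear function mapping each of [N]
    consecutive unit intervals affinely onto [[0, N]], alternately increasing
    and decreasing.  Its graph is the median of the [N] lines carrying its
    pieces, so it minimizes [sum_i |y - l_i x|] over [y].  With weights [W]
    large enough to act as exact penalties, the minimizer over
    [x_0, ..., x_(k-1)] of
      [sum_h W^(h+1) sum_i |x_h - l_i x_(h+1)| + sum_j |x_0 - j|]
    is given by [x_h = z(x_(h+1))], so that [x_0] is the [k]-fold iterate of [z]
    at [x_k], which crosses the levels [j] of the order of [N^(k+1)] times.
    Homogenized with a last coordinate [s], this sum is the support function of
    a zonotope with [O(N)] zones in dimension [d = k+2], and minimizing over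
    [x_0, ..., x_(k-1)] gives the support function of its section by the plane
    [x_0 = ... = x_(k-1) = 0]; each crossing contributes a vertex. *)

(** * Upper bound *)

Lemma finite_separation (R : realDomainType) (I : finType) (A B : pred I)
    (f : I -> R) :
  (forall p q, A p -> B q -> f q <= f p) ->
  exists w, (forall p, A p -> w <= f p) /\ (forall q, B q -> f q <= w).
Proof.
move=> AB; case: (pickP A) => [p0 Ap0|A0].
  case: (@arg_minP _ _ _ p0 A f Ap0) => p Ap minp.
  by exists (f p); split=> // q Bq; exact: AB.
case: (pickP B) => [q0 Bq0|B0].
  case: (@arg_maxP _ _ _ q0 B f Bq0) => q Bq maxq.
  by exists (f q); split=> // p; rewrite A0.
by exists 0; split=> p; rewrite ?A0 ?B0.
Qed.

(* Fourier-Motzkin elimination of the unknowns [w j]. *)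
Lemma farkas (R : realFieldType) (k : nat) (I : finType) (alpha : I -> R)
    (beta : nat -> I -> R) :
  (forall e : I -> R, (forall g, 0 <= e g) ->
     (forall j, (j < k)%N -> \sum_g e g * beta j g = 0) ->
     \sum_g e g * alpha g <= 0) ->
  exists w : nat -> R, forall g, alpha g + \sum_(j < k) w j * beta j g <= 0.
Proof.
elim: k I alpha beta => [|k IHk] I alpha beta H.
  exists (fun=> 0) => g; rewrite big_ord0 addr0.
  have := H (fun h => (h == g)%:R) (fun h => ler0n _ _) (fun j j0 => False_ind _ (notF j0)).
  rewrite (bigD1 g) //= eqxx mul1r big1 ?addr0// => h /negPf->.
  by rewrite mul0r.
pose b := beta k.
(* The pair [(p, q)] stands for the inequality [p] itself if [b p = 0], and for the positive
   combination cancelling the unknown [w k] if [b q < 0 < b p]; other pairs yield the trivial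
   inequality. *)
pose c1 (p q : I) : R :=
  if b p == 0 then 1 else if (0 < b p) && (b q < 0) then - b q else 0.
pose c2 (p q : I) : R :=
  if b p == 0 then 0 else if (0 < b p) && (b q < 0) then b p else 0.
pose comb (X : I -> R) (pq : I * I) := c1 pq.1 pq.2 * X pq.1 + c2 pq.1 pq.2 * X pq.2.
have c1_ge0 p q : 0 <= c1 p q.
  rewrite /c1; case: eqP => // _; case: andP => // -[_ /ltW]; lra.
have c2_ge0 p q : 0 <= c2 p q.
  by rewrite /c2; case: eqP => // _; case: andP => // -[/ltW].
have combb pq : comb b pq = 0.
  rewrite /comb /c1 /c2; case: eqP => [->|_]; first by rewrite mulr0 mul0r addr0.
  by case: andP => _; rewrite ?mul0r ?addr0//; ring.
have [|w wP] := IHk _ (comb alpha) (fun j => comb (beta j)).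
  move=> e e_ge0 e0.
  (* Multipliers of the pairs are pulled back to multipliers of the original inequalities. *)
  pose e' g := \sum_q e (g, q) * c1 g q + \sum_p e (p, g) * c2 p g.
  have e'E X : \sum_g e' g * X g = \sum_pq e pq * comb X pq.
    transitivity (\sum_p \sum_q e (p, q) * comb X (p, q)); last first.
      by rewrite pair_bigA; apply: eq_bigr => -[].
    under eq_bigr do rewrite /e' mulrDl !mulr_suml.
    rewrite big_split/= [X in _ + X]exchange_big -big_split/=.
    apply: eq_bigr => p _; rewrite -big_split; apply: eq_bigr => q _ /=.
    by rewrite /comb /=; ring.
  rewrite -e'E; apply: H => [g|j].
    by rewrite /e' addr_ge0// sumr_ge0// => q _; rewrite mulr_ge0.
  rewrite e'E ltnS leq_eqVlt => /orP[/eqP->|jk]; last exact: e0.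
  by rewrite big1// => pq _; rewrite combb mulr0.
pose gamma g := alpha g + \sum_(j < k) w j * beta j g.
have {wP} gammaP p q : c1 p q * gamma p + c2 p q * gamma q <= 0.
  apply: le_trans (wP (p, q)); rewrite le_eqVlt; apply/orP; left; apply/eqP.
  rewrite /gamma /comb/= 2!mulrDr !mulr_sumr addrACA -big_split/=; congr (_ + _).
  by apply: eq_bigr => j _; ring.
(* The value [z] of [w k] has to lie between the lower bounds, coming from [b q < 0], and the upper
   bounds, coming from [0 < b p]; the combined inequalities make these compatible. *)
have [|z [zlt zgt]] := @finite_separation R I [pred p | 0 < b p]
    [pred q | b q < 0] (fun g => - (gamma g / b g)).
  move=> p q /= bp bq; rewrite lerN2.
  have := gammaP p q; rewrite /c1 /c2 gt_eqF// bp bq/= => gpq.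
  have bq' : 0 < - b q by rewrite oppr_gt0.
  have -> : gamma q / b q = - gamma q / - b q by rewrite invrN mulrNN.
  by rewrite ler_pdivrMr// mulrAC ler_pdivlMr//; lra.
exists (fun j => if j == k then z else w j) => g.
rewrite big_ord_recr/= eqxx.
under eq_bigr => j _ do rewrite (ltn_eqF (ltn_ord j)).
rewrite addrA -/(gamma g) -/(b g).
have [bg|bg|bg] := ltgtP (b g) 0.
- have := zgt g bg => /=.
  have bg' : 0 < - b g by rewrite oppr_gt0.
  have -> : - (gamma g / b g) = gamma g / - b g by rewrite invrN mulrN.
  by rewrite ler_pdivrMr//; lra.
- have := zlt g bg => /=.
  by rewrite -mulNr ler_pdivlMr//; lra.
- have := gammaP g g; rewrite /c1 /c2 bg eqxx; lra.
Qed.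

(** Induction on the forms. A new form [f] takes one sign on each cell missing its kernel and at
    most three on any other cell; the latter are counted on [V :&: lker f], one dimension lower.
    With x = 2 * size s + 1, the count closes by x^(m+1) + 2 x^m <= (x + 2)^(m+1). *)
Lemma sign_patterns (R : realFieldType) (vT : vectType R)
    (s : seq 'Hom(vT, R^o)) (V : {vspace vT}) (m : nat) :
  (\dim V <= m.+1)%N ->
  exists L : seq (seq R), (size L <= 3 * (2 * size s + 1) ^ m)%N /\
    forall u, u \in V -> [seq Num.sg (f u : R) | f : 'Hom(vT, R^o) <- s] \in L.
Proof.
elim: s V m => [|f s IHs] V [|m] dimV.
- by exists [:: [::]]; split=> //= u _; rewrite inE.
- exists [:: [::]]; split=> [|u _]; last by rewrite inE.
  by rewrite /= muln0 add0n exp1n.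
(* The base case is a line, or 0 with [vpick V = 0]; the pattern at [k *: e] depends only on the
   sign of [k]. *)
- have VE : V = <[vpick V]>%VS.
    apply/eqP; rewrite eq_sym eqEdim -memvE memv_pick dim_vline vpick0.
    by have [->|_] := eqVneq V 0%VS; rewrite ?dimv0.
  set e := vpick V in VE.
  pose F (k : R) := [seq Num.sg k * Num.sg (g e : R) | g : 'Hom(vT, R^o) <- f :: s].
  exists (map F [:: 1; 0; -1]); split=> // u; rewrite VE => /vlineP[k ->].
  have -> : [seq Num.sg (g (k *: e) : R) | g : 'Hom(vT, R^o) <- f :: s] = F (Num.sg k).
    by apply: eq_map => g; rewrite linearZ /= sgrM sgr_id.
  apply: (map_f F); rewrite !inE.
  by case: (sgrP k); rewrite eqxx ?orbT.
have [L [sizeL LP]] := IHs _ _ dimV.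
have [Vf|Vf] := boolP (V <= lker f)%VS.
  exists (map (cons 0) L); split=> [|u uV]; last first.
    have /eqP fu : f u == 0 by rewrite -memv_ker (subvP Vf).
    by rewrite /= fu sgr0; apply: map_f; exact: LP.
  rewrite size_map; apply: (leq_trans sizeL); rewrite leq_mul2l/=.
  by rewrite leq_exp2r//= leq_add2r leq_mul2l/= leqnSn.
have dimK : (\dim (V :&: lker f) <= m.+1)%N.
  have := limg_ker_dim f V.
  have : (f @: V)%VS != 0%VS.
    apply: contra Vf => /eqP fV; apply/subvP => u uV.
    by rewrite memv_ker -memv0 -fV memv_img.
  by rewrite -dimv_eq0; lia.
have [L' [sizeL' LP']] := IHs _ _ dimK.
pose pat (u : vT) := [seq Num.sg (g u : R) | g : 'Hom(vT, R^o) <- s].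
pose W (sg : seq R) : set vT := [set u | u \in V /\ pat u = sg].
pose Z (sg : seq R) : Prop := exists2 u, W sg u & f u = 0.
(* Off the kernel of [f] the sign of [f] is constant on a cell [W sg] that
   misses this kernel, because cells are convex. *)
pose h (sg : seq R) : R := if `[< Z sg >] then 0 else Num.sg (f (xget 0 (W sg)) : R).
have cell sg u u' : W sg u -> W sg u' -> ~ Z sg -> Num.sg (f u : R) = Num.sg (f u' : R).
  move=> Wu Wu' nZ.
  have nz x : W sg x -> f x != 0.
    by move=> Wx; apply/eqP => fx; apply: nZ; exists x.
  have cross x y : W sg x -> W sg y -> (0 < f x :> R) -> (f y < 0 :> R) -> False.
    move=> [xV xp] [yV yp] fx fy; apply: nZ.
    exists ((- f y : R) *: x + (f x : R) *: y).
      split; first by rewrite rpredD// rpredZ.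
      rewrite -xp; apply/eq_in_map => g gs.
      have gxy : Num.sg (g x : R) = Num.sg (g y : R).
        have : pat x = pat y by rewrite xp yp.
        by rewrite /pat => /eq_in_map /(_ g gs).
      rewrite linearD !linearZ/=.
      change (Num.sg ((- f y : R) * (g x : R) + (f x : R) * (g y : R)) = Num.sg (g x : R)).
      have fy' : 0 < - f y :> R by rewrite oppr_gt0.
      case: (sgrP (g x : R)) gxy => gx.
      + rewrite gx => /eqP; rewrite eq_sym sgr_eq0 => /eqP ->.
        by rewrite !mulr0 addr0 sgr0.
      + move/esym/eqP; rewrite sgr_cp0 => gy.
        by apply/eqP; rewrite sgr_cp0 addr_gt0// mulr_gt0.
      + move/esym/eqP; rewrite sgr_cp0 => gy.
        apply/eqP; rewrite sgr_cp0 -oppr_gt0 opprD -!mulrN.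
        by rewrite addr_gt0// mulr_gt0 ?oppr_gt0.
    rewrite linearD !linearZ/=.
    change ((- f y : R) * (f x : R) + (f x : R) * (f y : R) = 0).
    by rewrite mulNr mulrC addNr.
  have := nz _ Wu; have := nz _ Wu'; rewrite !neq_lt => /orP[] fu' /orP[] fu.
  - by rewrite !ltr0_sg.
  - by have := cross _ _ Wu Wu' fu fu'.
  - by have := cross _ _ Wu' Wu fu' fu.
  - by rewrite !gtr0_sg.
exists ([seq h sg :: sg | sg <- L] ++
  (map (cons 1) L' ++ map (cons (-1)) L')); split.
  rewrite !size_cat !size_map.
  have : (2 * size (f :: s) + 1 = (2 * size s + 1) + 2)%N by rewrite /=; lia.
  move=> ->; set x := (2 * size s + 1)%N in sizeL sizeL' *.
  have : (x ^ m <= (x + 2) ^ m)%N by case: (m) => // m'; rewrite leq_exp2r// leq_addr.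
  move=> xm; apply: (@leq_trans (3 * ((x + 2) * x ^ m))%N).
    rewrite expnS in sizeL; rewrite mulnDl.
    have [Ly L'y] := (sizeL, sizeL'); clear -Ly L'y.
    move: (x ^ m)%N (x * x ^ m)%N (size L) (size L') Ly L'y => y z p q; lia.
  by rewrite leq_mul2l/= expnS leq_mul2l xm orbT.
move=> u uV; rewrite !mem_cat /= -/(pat u).
have Wu : W (pat u) u by [].
have [Zu|nZu] := pselect (Z (pat u)); last first.
  have -> : Num.sg (f u : R) = h (pat u).
    rewrite /h asboolF//; apply: cell nZu => //.
    exact: (@xgetPex _ 0 (W (pat u)) (ex_intro _ u Wu)).
  by rewrite (map_f (fun sg => h sg :: sg)) ?LP.
have : pat u \in L'.
  case: Zu => z [zV zp] fz; rewrite -zp; apply: LP'.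
  by rewrite memv_cap zV memv_ker fz eqxx.
case: (sgrP (f u : R)) => fu uL'.
- have -> : 0 = h (pat u) by rewrite /h asboolT.
  by rewrite (map_f (fun sg => h sg :: sg)) ?LP.
- by rewrite (map_f (cons 1)) ?orbT.
- by rewrite (map_f (cons (-1))) ?orbT.
Qed.

(** * Vertices of a central section *)

Lemma vertices_mem (R : realType) (d : nat) (P : set 'rV[R]_d) v :
  vertices P v -> P v.
Proof. by case=> u [b [_ Pv]]; have [] : (P `&` [set x | (x *m u) 0 0 = b]) v by rewrite -Pv. Qed.

Lemma scalemx_dot (R : realType) (d : nat) k (x : 'rV[R]_d) (u : 'cV[R]_d) :
  ((k *: x) *m u) 0 0 = k * (x *m u) 0 0.
Proof. by rewrite -scalemxAl mxE. Qed.

Lemma subr_dot (R : realType) (d : nat) (x y : 'rV[R]_d) (u : 'cV[R]_d) :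
  ((x - y) *m u) 0 0 = (x *m u) 0 0 - (y *m u) 0 0.
Proof. by rewrite mulmxBl !mxE. Qed.

Lemma mulmx_zonotope (R : realType) (d n : nat) (c : 'rV[R]_d)
    (a : 'I_n -> 'rV[R]_d) (l : 'I_n -> R) (u : 'cV[R]_d) :
  ((c + \sum_i l i *: a i) *m u) 0 0 = (c *m u) 0 0 + \sum_i l i * (a i *m u) 0 0.
Proof.
rewrite mulmxDl mxE; congr (_ + _).
by rewrite mulmx_suml summxE; apply: eq_bigr => i _; rewrite scalemx_dot.
Qed.

(* A vertex of a central section is the intersection of the section with a face
   of the whole zonotope: by Farkas' lemma, the functional [u] exposing the
   vertex can be corrected by one that is constant on the section. *)
Lemma vertex_face (R : realType) (d n : nat) (c : 'rV[R]_d)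
    (a : 'I_n -> 'rV[R]_d) (L : set 'rV[R]_d) (v : 'rV[R]_d) :
  is_affine_plane L -> vertices (zonotope_at c a `&` L) v ->
  exists (l : 'I_n -> R) (w : 'cV[R]_d),
    [/\ v = c + \sum_i l i *: a i,
        forall i, l i * (a i *m w) 0 0 = `|(a i *m w) 0 0|
      & forall y, (zonotope_at c a `&` L) y -> (y *m w) 0 0 = (v *m w) 0 0 -> y = v].
Proof.
move=> [p [U [_ LE]]] vP; have [[l lB vE] Lv] := vertices_mem _ _ _ _ vP.
case: vP => u [b [ub uv]].
have vb : (v *m u) 0 0 = b.
  by have [] : (zonotope_at c a `&` L `&` [set x | (x *m u) 0 0 = b]) v by rewrite -uv.
(* The kernel of [f] is the direction [U] of the plane, so functionals factoring through [f] are
   constant on [L]. *)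
pose f : 'End('rV[R]_d) := (\1 - projv U)%VF.
have fE x : f x = x - projv U x by rewrite add_lfunE id_lfunE opp_lfunE.
have f0 x : (f x == 0) = (x \in U).
  rewrite fE subr_eq0; apply/eqP/idP => [->|xU]; first exact: memv_proj.
  by rewrite projv_id.
(* Generators of the cone of feasible directions of the zonotope at [v]: each moves one coefficient
   [l i] towards 1 or -1. *)
pose gen (g : 'I_n + 'I_n) : 'rV[R]_d := match g with
  | inl i => (1 - l i) *: a i | inr i => - (1 + l i) *: a i end.
pose beta j g := oapp (fun j' : 'I_d => f (gen g) 0 j') 0 (insub j).
have [|w wP] := @farkas R d _ (fun g => (gen g *m u) 0 0) beta.
  move=> e e0 eU.
  pose y := \sum_g e g *: gen g.
  have yU : y \in U.
    rewrite -f0; apply/eqP/rowP => j; rewrite mxE -[RHS](eU j (ltn_ord j)).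
    rewrite linear_sum summxE; apply: eq_bigr => g _.
    by rewrite linearZ mxE /beta valK.
  have -> : \sum_g e g * (gen g *m u) 0 0 = (y *m u) 0 0.
    rewrite /y mulmx_suml summxE; apply: eq_bigr => g _.
    by rewrite scalemx_dot.
  (* This [t] gives [t * e g <= 1], which keeps the coefficients of [v + t *: y] in [-1, 1]. *)
  pose t := (1 + \sum_g e g)^-1.
  have S0 : 0 <= \sum_g e g by rewrite sumr_ge0.
  have t0 : 0 < t by rewrite invr_gt0; lra.
  have te g : 0 <= t * e g <= 1.
    apply/andP; split; first by rewrite mulr_ge0 ?e0// ltW.
    rewrite mulrC ler_pdivrMr; last by lra.
    rewrite mul1r (bigD1 g)//=.
    have : 0 <= \sum_(i | i != g) e i by rewrite sumr_ge0.
    lra.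
  have /ub : (zonotope_at c a `&` L) (v + t *: y).
    split; last first.
      rewrite LE in Lv *; case: Lv => q qU <-; exists (q + t *: y); last by rewrite addrA.
      by rewrite /= rpredD// rpredZ.
    exists (fun i => l i + t * e (inl i) * (1 - l i) - t * e (inr i) * (1 + l i)).
      move=> i; have := te (inl i); have := te (inr i); have := lB i.
      move: (t * e (inl i)) (t * e (inr i)) (l i) => r s z /andP[z1 z2] /andP[s1 s2] /andP[r1 r2].
      by apply/andP; split; nra.
    rewrite vE -addrA; congr (_ + _).
    rewrite /y big_sumType/= scalerDr !scaler_sumr -!big_split/=.
    by apply: eq_bigr => i _; rewrite !scalerA -!scalerDl; congr (_ *: _); ring.
  by rewrite mulmxDl mxE scalemx_dot vb gerDl pmulr_rle0.
pose w' := u + lin1_mx f *m (\col_j w j).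
have w'E x : (x *m w') 0 0 = (x *m u) 0 0 + \sum_(j < d) w j * f x 0 j.
  rewrite mulmxDr mulmxA mul_rV_lin1 mxE; congr (_ + _); rewrite mxE.
  by apply: eq_bigr => j _; rewrite mxE mulrC.
have genP g : (gen g *m w') 0 0 <= 0.
  rewrite w'E; apply: le_trans (wP g); rewrite lerD2l le_eqVlt; apply/orP; left.
  by apply/eqP/eq_bigr => j _; rewrite /beta valK.
exists l, w'; split=> // [i|y [Zy Ly]].
  (* The inequalities (1 - l) s <= 0 and -(1 + l) s <= 0 push [l i] to the end of [-1, 1] that has
     the sign of [s]. *)
  have := genP (inl i); have := genP (inr i); rewrite /= !scalemx_dot.
  have /andP[] := lB i; move: ((a i *m w') 0 0) => s l1 l2 g1 g2.
  have [s0|s0|->] := ltgtP s 0; last by rewrite mulr0 normr0.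
    by rewrite ltr0_norm//; nra.
  by rewrite gtr0_norm//; nra.
have fvy : f y = f v.
  move: Ly Lv; rewrite LE => -[y' y'U <-] [v' v'U <-]; rewrite !linearD/=; congr (_ + _).
  by transitivity (0 : 'rV[R]_d); [|symmetry]; apply/eqP; rewrite f0.
rewrite !w'E fvy => /addIr yv.
have : (zonotope_at c a `&` L `&` [set x | (x *m u) 0 0 = b]) y by split=> //=; rewrite yv.
by rewrite -uv.
Qed.

(** Linear in the normal [u], with the generator [x] fixed: the patterns to be counted are those of
    normals. *)
Definition row_form (R : realType) (d : nat) (x : 'rV[R]_d) (u : 'cV[R]_d) : R^o :=
  (x *m u) 0 0.

Fact row_form_is_linear (R : realType) (d : nat) (x : 'rV[R]_d) : linear (row_form _ _ x).
Proof. by move=> k u v; rewrite /row_form mulmxDr -scalemxAr !mxE. Qed.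

HB.instance Definition _ (R : realType) (d : nat) (x : 'rV[R]_d) :=
  GRing.isLinear.Build R 'cV[R]_d R^o _ (row_form _ _ x) (row_form_is_linear R d x).

(** A vertex is determined by the signs of its normal on the generators: if [v] and [v'] share them,
    both maximize the normal of [v'] over the zonotope, and the last clause of [vertex_face]
    identifies them. *)
Lemma section_vertices_le (R : realType) (d n : nat) (P : set 'rV[R]_d.+1) :
  is_central_section n P -> (vertices P #<= `I_(3 * (2 * n + 1) ^ d))%card.
Proof.
case=> Z [_ [L [[c [a [_ ->]]] _ LL _ ->]]].
set P' := _ `&` L.
pose form i : 'Hom('cV[R]_d.+1, R^o) :=
  linfun (row_form _ _ (a i)).
have formE i u : form i u = (a i *m u) 0 0.
  by rewrite /form lfunE.
have [//|S [sizeS SP]] := @sign_patterns R _ (map form (enum 'I_n)) fullv d _.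
  by rewrite dimvf /dim /= muln1.
rewrite size_map size_enum_ord in sizeS.
pose face v (lw : ('I_n -> R) * 'cV[R]_d.+1) := [/\ v = c + \sum_i lw.1 i *: a i,
        forall i, lw.1 i * (a i *m lw.2) 0 0 = `|(a i *m lw.2) 0 0|
      & forall y, P' y -> (y *m lw.2) 0 0 = (v *m lw.2) 0 0 -> y = v].
have [F FP] : exists F, forall v, vertices P' v -> face v (F v).
  have : forall v, exists lw, vertices P' v -> face v lw.
    move=> v; have [vP|nvP] := pselect (vertices P' v); last by exists (fun=> 0, 0).
    by have [l [w lw]] := vertex_face _ _ _ _ _ _ _ LL vP; exists (l, w).
  by move=> /(@choice _ _ (fun v lw => vertices P' v -> face v lw)) [F ?]; exists F.
pose sgn v := [seq Num.sg (f (F v).2 : R) | f : 'Hom('cV[R]_d.+1, R^o) <- map form (enum 'I_n)].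
have sgn_inj v v' : vertices P' v -> vertices P' v' -> sgn v = sgn v' -> v = v'.
  move=> vP v'P; rewrite /sgn -[in LHS]map_comp -[in RHS]map_comp => /eq_in_map sE.
  have [vE vl _] := FP _ vP; have [v'E v'l v'u] := FP _ v'P.
  apply: v'u; first exact: vertices_mem.
  rewrite {1}vE [X in _ = (X *m _) 0 0]v'E !mulmx_zonotope; congr (_ + _).
  apply: eq_bigr => i _; rewrite v'l.
  have /= := sE i; rewrite mem_enum => /(_ isT); rewrite !formE => sgE.
  have [s0|s0] := eqVneq ((a i *m (F v').2) 0 0) 0; first by rewrite s0 mulr0 normr0.
  rewrite normrEsg -sgE; congr (_ * _).
  have s1 : (a i *m (F v).2) 0 0 != 0 by rewrite -sgr_eq0 sgE sgr_eq0.
  by apply: (mulIf s1); rewrite vl normrEsg.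
suff /card_le_trans : (vertices P' #<= `I_(size S))%card.
  by apply; rewrite card_le_II.
pose idx v := index (sgn v) S.
have /card_eqPle[_ ] : (idx @` vertices P' #= vertices P')%card.
  apply: inj_card_eq => v v' /set_mem vP /set_mem v'P idxE.
  apply: sgn_inj => //; by apply: (@index_inj _ [::] S) => //; apply: SP; exact: memvf.
move/card_le_trans; apply; apply: subset_card_le => _ [v vP <-].
by rewrite /= /idx index_mem SP ?memvf.
Qed.

(** * Lower bound *)

Section Zigzag.
Variables (R : realType) (N : nat).
Hypothesis N_odd : odd N.

Let N_gt0 : 0 < N%:R :> R.
Proof. by rewrite ltr0n; case: (N) N_odd. Qed.

(** The line [zig i] rises from 0 to [N] over [i, i + 1] for even [i] and falls from [N] to 0 for
    odd [i]; [zag i] is its inverse. *)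
Definition slope (i : nat) : R := (-1) ^+ i * N%:R.
Definition intercept (i : nat) : R := if odd i then (N * i.+1)%:R else - (N * i)%:R.
Definition zig (i : nat) (x : R) : R := slope i * x + intercept i.
Definition zag (i : nat) (y : R) : R :=
  if odd i then i.+1%:R - y / N%:R else i%:R + y / N%:R.

(* The sign of [y - l_i x] for [y] in [(0, N)], [x] in the [b]-th unit interval
   and [i != b]. *)
Definition zig_sign (b i : nat) : R := (-1) ^+ i * (-1) ^+ (i < b)%N.

Lemma zagK i y : zig i (zag i y) = y.
Proof.
have N0 := N_gt0; rewrite /zig /zag /slope /intercept -signr_odd.
by case: (odd i); rewrite /= ?expr0 ?expr1 natrM; field; rewrite gt_eqF.
Qed.

Lemma zag_itv i y : 0 < y < N%:R -> i%:R < zag i y < i.+1%:R.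
Proof.
move=> /andP[y0 yN]; rewrite /zag -natr1.
have y0' : 0 < y / N%:R by rewrite divr_gt0.
have yN' : y / N%:R < 1 by rewrite ltr_pdivrMr// mul1r.
by case: (odd i); apply/andP; split; lra.
Qed.

(** Over the interval [b], every other line stays above [N] or below 0. *)
Lemma zig_sign_gt0 b i x y : i != b -> b%:R < x < b.+1%:R -> 0 < y < N%:R ->
  0 < zig_sign b i * (y - zig i x).
Proof.
move=> ib /andP[bx xb] /andP[y0 yN]; have N0 := N_gt0.
rewrite /zig_sign /zig /slope /intercept -(signr_odd R i).
case: ltnP => [i_b|b_i].
  have : i.+1%:R <= b%:R :> R by rewrite ler_nat.
  by case: (odd i); rewrite /= ?expr0 ?expr1 natrM -!natr1 in bx xb * => ?; nra.
have : b.+1%:R <= i%:R :> R by rewrite ler_nat ltn_neqAle eq_sym ib.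
by case: (odd i); rewrite /= ?expr0 ?expr1 natrM -!natr1 in bx xb * => ?; nra.
Qed.

Lemma zig_sign_norm b i : `|zig_sign b i| = 1.
Proof. by rewrite /zig_sign normrM !normr_sign mulr1. Qed.

Lemma sum_alternating (m : nat) : \sum_(i < m) (-1) ^+ i = (odd m)%:R :> R.
Proof.
elim: m => [|m IHm]; first by rewrite big_ord0.
by rewrite big_ord_recr/= IHm -signr_odd; case: (odd m); rewrite /= ?expr0 ?expr1; ring.
Qed.

(** Median property: over the interval [b], equally many other lines lie above and below. As [N] is
    odd, the full sum is 1 minus twice the alternating sum below [b], that is (-1)^b, which is the
    term of [b]. *)
Lemma sum_zig_sign (b : 'I_N) : \sum_(i < N | i != b) zig_sign b i = 0.
Proof.
have := sum_alternating N; rewrite N_odd => sN.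
have : \sum_(i < N) zig_sign b i = (-1) ^+ b.
  have -> : \sum_(i < N) zig_sign b i =
      \sum_(i < N) (-1) ^+ i - 2 * \sum_(i < N | (i < b)%N) (-1) ^+ i.
    rewrite [in X in _ - X]big_mkcond mulr_sumr -sumrB; apply: eq_bigr => i _.
    by rewrite /zig_sign; case: ifP => _; rewrite ?expr0 ?expr1; ring.
  rewrite sN -(big_ord_widen N (fun i => (-1) ^+ i : R) (ltnW (ltn_ord b))).
  rewrite sum_alternating -[RHS]signr_odd.
  by case: (odd b); rewrite /= ?expr0 ?expr1; ring.
rewrite (bigD1 b)//= /zig_sign ltnn expr0 mulr1 => /eqP.
by rewrite addrC -subr_eq0 addrK => /eqP.
Qed.

(** * Points and multipliers with a prescribed address *)

Section Address.
Variable b : nat -> nat.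
Hypothesis b_lt : forall h, (b h < N)%N.

(* The point [(x_0, x_1, ...)] with [x_h = l_i x_(h+1)], [i = b (h+1)], and with
   [x_h] in the [b h]-th unit interval. *)
Fixpoint pos (h : nat) : R :=
  if h is h'.+1 then zag (b h) (pos h') else (b 0%N)%:R + 2^-1.

Lemma pos_itv h : (b h)%:R < pos h < (b h).+1%:R.
Proof.
elim: h => [|h /andP[IH1 IH2]] /=; first by rewrite -[(b 0%N).+1%:R]natr1; apply/andP; split; lra.
apply: zag_itv; rewrite (le_lt_trans _ IH1) ?ler0n//= (lt_le_trans IH2)//.
by rewrite ler_nat b_lt.
Qed.

Lemma pos_bound h : 0 < pos h < N%:R.
Proof.
have /andP[h1 h2] := pos_itv h; rewrite (le_lt_trans _ h1) ?ler0n//=.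
by rewrite (lt_le_trans h2)// ler_nat b_lt.
Qed.

Lemma zig_pos h : zig (b h.+1) (pos h.+1) = pos h.
Proof. exact: zagK. Qed.

Variables (M : nat) (W : R).
Hypotheses (W_M : M%:R < W) (W_N : N%:R * N%:R < W).

Let W_gt0 : 0 < W. Proof. exact: le_lt_trans W_M. Qed.

(** The sign of x_0 - j: the half in [pos 0] keeps x_0 strictly between the levels [b 0] and
    [b 0 + 1]. *)
Definition last_sign (j : nat) : R := if (j <= b 0)%N then 1 else -1.

(* The multiplier of the vanishing term [x_h - l_i x_(h+1)], [i = b (h+1)]: it is
   forced by the vanishing of the coordinate [h] of the vertex. *)
Fixpoint theta (h : nat) : R :=
  if h is h'.+1 then
    (\sum_(i < N) (if i == b h :> nat then theta h' else zig_sign (b h) i) * slope i) / W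
  else - (\sum_(j < M) last_sign j) / W.

Definition coeff (h i : nat) : R :=
  if i == b h.+1 then theta h else zig_sign (b h.+1) i.

Lemma last_sign_norm j : `|last_sign j| = 1.
Proof. by rewrite /last_sign; case: ifP; rewrite ?normrN normr1. Qed.

(** Exactness of the penalties: the numerators are at most [M] and [N * N] in absolute value, both
    below [W]. Strictness separates [theta h] from the signs in [address_coeff_inj]. *)
Lemma theta_lt1 h : `|theta h| < 1.
Proof.
elim: h => [|h IHh] /=; rewrite normrM normfV (gtr0_norm W_gt0) ltr_pdivrMr// mul1r.
  rewrite normrN (le_lt_trans _ W_M)//; apply: le_trans (ler_norm_sum _ _ _) _.
  by under eq_bigr do rewrite last_sign_norm; rewrite sumr_const card_ord.
apply: le_lt_trans W_N; apply: le_trans (ler_norm_sum _ _ _) _.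
rewrite mulr_natl -[N in X in _ <= _ *+ X]card_ord -sumr_const; apply: ler_sum => i _.
rewrite normrM /slope normrMsign normr_nat ler_piMl//.
by case: ifP => _; rewrite ?(ltW IHh)// zig_sign_norm.
Qed.

Lemma coeff_norm h i : `|coeff h i| <= 1.
Proof. by rewrite /coeff; case: ifP => _; rewrite ?zig_sign_norm// ltW ?theta_lt1. Qed.

(** By the median property the signs cancel, leaving the multiplier of the vanishing term. *)
Lemma sum_coeff h : \sum_(i < N) coeff h i = theta h.
Proof.
rewrite (bigD1 (Ordinal (b_lt h.+1)))//= /coeff eqxx -[RHS]addr0; congr (_ + _).
rewrite -[RHS](sum_zig_sign (Ordinal (b_lt h.+1))); apply: eq_bigr => i ib.
by rewrite ifN.
Qed.

Lemma coeff_tight h i :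
  coeff h i * (pos h - zig i (pos h.+1)) = `|pos h - zig i (pos h.+1)|.
Proof.
rewrite /coeff; case: eqP => [->|/eqP ib].
  by rewrite zig_pos subrr mulr0 normr0.
have := zig_sign_gt0 _ _ _ _ ib (pos_itv h.+1) (pos_bound h) => s0.
by rewrite -[LHS](gtr0_norm s0) normrM zig_sign_norm mul1r.
Qed.

Lemma coeff_unique h i m : i != b h.+1 ->
  m * (pos h - zig i (pos h.+1)) = `|pos h - zig i (pos h.+1)| -> m = coeff h i.
Proof.
move=> ib; rewrite -coeff_tight; apply: mulIf.
have := zig_sign_gt0 _ _ _ _ ib (pos_itv h.+1) (pos_bound h).
by apply: contraTneq => ->; rewrite mulr0 ltxx.
Qed.

Lemma last_sign_gt0 j : 0 < last_sign j * (pos 0 - j%:R).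
Proof.
rewrite /last_sign /=; case: leqP => jb.
  have : j%:R <= (b 0)%:R :> R by rewrite ler_nat.
  lra.
have : (b 0).+1%:R <= j%:R :> R by rewrite ler_nat.
by rewrite -[(b 0%N).+1%:R]natr1; lra.
Qed.

Lemma last_sign_tight j : last_sign j * (pos 0 - j%:R) = `|pos 0 - j%:R|.
Proof.
by rewrite -[LHS](gtr0_norm (last_sign_gt0 j)) normrM last_sign_norm mul1r.
Qed.

Lemma last_sign_unique j m : m * (pos 0 - j%:R) = `|pos 0 - j%:R| -> m = last_sign j.
Proof.
rewrite -last_sign_tight; apply: mulIf; have := last_sign_gt0 j.
by apply: contraTneq => ->; rewrite mulr0 ltxx.
Qed.

End Address.
End Zigzag.

(** * Generators of the zonotope and the vertices given by addresses *)

Section Generators.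
Variables (R : realType) (k N M : nat).
Hypotheses (N_odd : odd N) (NM : (N <= M)%N) (M_gt1 : (1 < M)%N).

Let W : R := N%:R * N%:R + M%:R + 1.

Let W_M : M%:R < W.
Proof. by rewrite /W; have := mulr_ge0 (ler0n R N) (ler0n R N); lra. Qed.

Let W_N : N%:R * N%:R < W.
Proof. by rewrite /W; have := ler0n R M; lra. Qed.

Let W_gt0 : 0 < W. Proof. exact: le_lt_trans W_M. Qed.

Let WX_gt0 h : 0 < W ^+ h. Proof. exact: exprn_gt0. Qed.

Notation zigI := ('I_k * 'I_N + 'I_M)%type.

Let e (j : nat) : 'rV[R]_k.+2 := \row_l (l == j :> nat)%:R.

(* The coordinates of ['rV_k.+2] are [x_0, ..., x_k, s]. *)
Let zig_gen (h i : nat) : 'rV[R]_k.+2 :=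
  W ^+ h.+1 *: (e h - slope R N i *: e h.+1 - intercept R N i *: e k.+1).

Let last_gen (j : nat) : 'rV[R]_k.+2 := e 0 - j%:R *: e k.+1.

Definition zigzag_gen (g : zigI) : 'rV[R]_k.+2 :=
  match g with inl (h, i) => zig_gen h i | inr j => last_gen j end.

Let zig_gen_coord h i l : (h < k)%N -> (l <= k)%N ->
  zig_gen h i 0 (inord l) = W ^+ h.+1 * ((h == l)%:R - slope R N i * (h.+1 == l)%:R).
Proof.
move=> hk lk; rewrite /zig_gen !mxE inordK; last by lia.
by rewrite (ltn_eqF (_ : l < k.+1)%N)// mulr0 subr0 !(eq_sym l).
Qed.

Let last_gen_coord j l : (l <= k)%N -> last_gen j 0 (inord l) = (0 == l)%:R.
Proof.
move=> lk; rewrite /last_gen !mxE inordK; last by lia.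
by rewrite (ltn_eqF (_ : l < k.+1)%N)// mulr0 subr0 (eq_sym l).
Qed.

Let e_mul j (u : 'cV[R]_k.+2) : (j <= k.+1)%N -> (e j *m u) 0 0 = u (inord j) 0.
Proof.
move=> jk; rewrite mxE (bigD1 (inord j))//= big1 => [|l lj].
  by rewrite mxE inordK// eqxx mul1r addr0.
rewrite mxE (_ : (l == j :> nat) = false) ?mul0r//.
by apply: contraNF lj => /eqP <-; rewrite inord_val.
Qed.

Section Address.
Variable b : nat -> nat.
Hypothesis b_lt : forall h, (b h < N)%N.

Notation x := (pos R N b).

(** The point (x_0, ..., x_k), homogenized by s = 1, serves as the functional exposing the vertex of
    the address. *)
Definition address_dir : 'cV[R]_k.+2 := \col_l (if l == k.+1 :> nat then 1 else x l).

Let dirE j : (j <= k)%N -> address_dir (inord j) 0 = x j.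
Proof. by move=> jk; rewrite mxE inordK ?ltn_eqF// ltnW. Qed.

Let dir_last : address_dir (inord k.+1) 0 = 1.
Proof. by rewrite mxE inordK ?eqxx. Qed.

Let zig_gen_dir h i : (h < k)%N ->
  (zig_gen h i *m address_dir) 0 0 = W ^+ h.+1 * (x h - zig R N i (x h.+1)).
Proof.
move=> hk; rewrite /zig_gen scalemx_dot !subr_dot !scalemx_dot !e_mul; try lia.
by rewrite dir_last !dirE ?(ltnW hk)// /zig; ring.
Qed.

Let last_gen_dir j : (last_gen j *m address_dir) 0 0 = x 0%N - j%:R.
Proof. by rewrite /last_gen subr_dot scalemx_dot !e_mul// dirE// dir_last mulr1. Qed.

Let coord_sum (F : nat -> R) j : (j < k)%N ->
  \sum_(h < k) F h * (h == j :> nat)%:R = F j.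
Proof.
move=> jk; rewrite (bigD1 (Ordinal jk))//= eqxx mulr1 big1 ?addr0// => h hj.
by rewrite (_ : (h == j :> nat) = false) ?mulr0//; apply: negbTE hj.
Qed.

(** Only the blocks [j] and [j - 1] of generators meet coordinate [j], with the last generators in
    place of the latter if [j = 0]. Given [sum_coeff], the vanishing of this coordinate is the
    recursion defining [theta]. *)
Let coordE (p : nat -> nat -> R) (q : nat -> R) j : (j < k)%N ->
  (\sum_(h < k) \sum_(i < N) p h i *: zig_gen h i + \sum_(i < M) q i *: last_gen i)
    0 (inord j) =
  W ^+ j.+1 * (\sum_(i < N) p j i) +
  (if j is j'.+1 then - (W ^+ j * \sum_(i < N) p j' i * slope R N i) else \sum_(i < M) q i).
Proof.
move=> jk; rewrite mxE !summxE.
have -> : \sum_(i < M) (q i *: last_gen i) 0 (inord j) = (0%N == j)%:R * \sum_(i < M) q i.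
  by rewrite mulr_sumr; apply: eq_bigr => i _; rewrite mxE last_gen_coord ?(ltnW jk)// mulrC.
have -> : \sum_(h < k) (\sum_(i < N) p h i *: zig_gen h i) 0 (inord j) =
    \sum_(h < k) (W ^+ h.+1 * \sum_(i < N) p h i) * (h == j :> nat)%:R -
    \sum_(h < k) (W ^+ h.+1 * \sum_(i < N) p h i * slope R N i) * (h.+1 == j :> nat)%:R.
  rewrite -sumrB; apply: eq_bigr => h _; rewrite summxE.
  rewrite !mulr_sumr !mulr_suml -sumrB; apply: eq_bigr => i _.
  by rewrite mxE zig_gen_coord ?(ltnW jk)//; ring.
rewrite (coord_sum (fun h => W ^+ h.+1 * \sum_(i < N) p h i))// -addrA; congr (_ + _).
case: j jk => [|j] jk.
  by rewrite eqxx mul1r big1 ?oppr0 ?add0r// => h _; rewrite mulr0.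
under eq_bigr do rewrite eqSS.
rewrite (coord_sum (fun h => W ^+ h.+1 * \sum_(i < N) p h i * slope R N i)); last exact: ltnW.
by rewrite mul0r addr0.
Qed.

Definition address_coeff (g : zigI) : R :=
  match g with
  | inl (h, i) => coeff R N b M W h i
  | inr j => last_sign R b j
  end.

Definition address_vertex : 'rV[R]_k.+2 := \sum_g address_coeff g *: zigzag_gen g.

Let sum_gen (l : zigI -> R) (p : nat -> nat -> R) (q : nat -> R) :
  (forall (h : 'I_k) (i : 'I_N), l (inl (h, i)) = p h i) ->
  (forall j : 'I_M, l (inr j) = q j) ->
  \sum_g l g *: zigzag_gen g =
  \sum_(h < k) \sum_(i < N) p h i *: zig_gen h i + \sum_(i < M) q i *: last_gen i.
Proof.
move=> lp lq; rewrite big_sumType/=; congr (_ + _).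
  rewrite pair_bigA; apply: eq_bigr => -[h i] _ /=; by rewrite lp.
by apply: eq_bigr => j _; rewrite lq.
Qed.

Lemma address_vertex_coord j : (j < k)%N -> address_vertex 0 (inord j) = 0.
Proof.
move=> jk; rewrite /address_vertex (sum_gen _ (coeff R N b M W) (last_sign R b))// coordE//.
rewrite sum_coeff//; case: j jk => [|j] jk.
  by rewrite /= expr1 mulrC divfK ?addNr// gt_eqF.
rewrite /= exprS [W * _]mulrC -mulrA [W * _]mulrC divfK ?gt_eqF//.
by rewrite subrr.
Qed.

Lemma address_coeff_tight g :
  address_coeff g * (zigzag_gen g *m address_dir) 0 0 = `|(zigzag_gen g *m address_dir) 0 0|.
Proof.
case: g => [[h i]|j] /=; last by rewrite last_gen_dir last_sign_tight.
by rewrite zig_gen_dir// normrM (gtr0_norm (WX_gt0 _)) mulrCA coeff_tight.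
Qed.

Lemma address_coeff_bound g : -1 <= address_coeff g <= 1.
Proof.
rewrite -ler_norml; case: g => [[h i]|j] /=; last by rewrite last_sign_norm.
exact: coeff_norm.
Qed.

(** Tightness fixes the coefficient of every generator on which the functional is nonzero. One
    coefficient remains in each block [h]; coordinate [h] determines it, by induction on [h]. *)
Lemma address_coeff_unique (l : zigI -> R) :
  (forall g, l g * (zigzag_gen g *m address_dir) 0 0 = `|(zigzag_gen g *m address_dir) 0 0|) ->
  (forall j, (j < k)%N -> (\sum_g l g *: zigzag_gen g) 0 (inord j) = 0) ->
  forall g, l g = address_coeff g.
Proof.
move=> lt l0.
have lq (j : 'I_M) : l (inr j) = last_sign R b j.
  have := lt (inr j); rewrite /= last_gen_dir; exact: last_sign_unique.
pose p (h i : nat) :=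
  if insub h is Some h' then if insub i is Some i' then l (inl (h', i')) else 0 else 0.
have lp (h : 'I_k) (i : 'I_N) : l (inl (h, i)) = p h i by rewrite /p !valK.
have pE h i : (h < k)%N -> (i < N)%N -> i != b h.+1 -> p h i = coeff R N b M W h i.
  move=> hk iN ib; have := lt (inl (Ordinal hk, Ordinal iN)).
  rewrite lp /= zig_gen_dir// normrM (gtr0_norm (WX_gt0 _)) mulrCA.
  by move/(mulfI (lt0r_neq0 (WX_gt0 _))); exact: coeff_unique.
have pb h : (h < k)%N -> \sum_(i < N) p h i = theta R N b M W h -> 
    forall i, (i < N)%N -> p h i = coeff R N b M W h i.
  move=> hk; rewrite -sum_coeff// => sE i iN.
  have [iE|] := eqVneq i (b h.+1); last exact: pE.
  move: sE; rewrite (bigD1 (Ordinal iN))// [RHS](bigD1 (Ordinal iN))//=.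
  rewrite (eq_bigr (fun i' : 'I_N => coeff R N b M W h i')) => [/addIr//|i' i'i].
  by apply: pE => //; rewrite -iE.
have pall h i : (h < k)%N -> (i < N)%N -> p h i = coeff R N b M W h i.
  elim: h i => [|h IHh] i hk iN.
    apply: pb => //; have := l0 _ hk; rewrite (sum_gen _ _ _ lp lq) coordE// expr1.
    move=> /eqP; rewrite addr_eq0 => /eqP W0.
    by apply: (mulfI (lt0r_neq0 W_gt0)); rewrite W0 /= mulrC divfK// gt_eqF.
  apply: pb => //; have := l0 _ hk; rewrite (sum_gen _ _ _ lp lq) coordE//.
  move=> /eqP; rewrite subr_eq0 exprSr -mulrA => /eqP W0.
  have {}W0 := mulfI (lt0r_neq0 (WX_gt0 _)) W0.
  apply: (mulfI (lt0r_neq0 W_gt0)); rewrite W0 [theta _ _ _ _ _ _]/= mulrC divfK ?gt_eqF//.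
  by apply: eq_bigr => i' _; rewrite IHh// ltnW.
by case=> [[h i]|j] //=; rewrite lp pall.
Qed.

End Address.

(** The signs on the last generators locate x_0, as [N <= M] provides a level separating two
    candidates. In block [h], the one coefficient of absolute value below 1 sits at [b h.+1]. *)
Lemma address_coeff_inj (b b' : nat -> nat) :
  (forall h, (b h < N)%N) -> (forall h, (b' h < N)%N) ->
  address_coeff b =1 address_coeff b' ->
  forall h, (h <= k)%N -> b h = b' h.
Proof.
move=> bN b'N bb' [_|h hk].
  wlog lt_bb' : b b' bN b'N bb' / (b 0 < b' 0)%N.
    by move=> H; have [/H|/H/esym|//] := ltngtP (b 0%N) (b' 0%N); apply.
  have jM : (b' 0 < M)%N by apply: leq_trans NM.
  have := bb' (inr (Ordinal jM)); rewrite /= /last_sign leqnn leqNgt lt_bb' /= => /eqP.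
  by rewrite eq_sym -subr_eq0 opprK -(natrD _ 1 1) pnatr_eq0.
apply/eqP/negPn/negP => ne.
have := bb' (inl (Ordinal hk, Ordinal (bN h.+1))).
rewrite /= /coeff eqxx (negPf ne) => th.
by have := theta_lt1 R N b M W W_M W_N h; rewrite th zig_sign_norm ltxx.
Qed.

(** * The generators span and are pairwise non-parallel *)

Let N_gt0 : (0 < N)%N.
Proof. by case: (N) N_odd. Qed.

Let slope_neq0 i : slope R N i != 0.
Proof. by rewrite /slope mulf_neq0 ?signr_eq0// pnatr_eq0 -lt0n. Qed.

Let zig_gen_last h i : (h < k)%N ->
  zig_gen h i 0 (inord k.+1) = - (W ^+ h.+1 * intercept R N i).
Proof.
move=> hk; rewrite /zig_gen !mxE inordK// eqxx eqSS.
rewrite (gtn_eqF hk) (gtn_eqF (ltnW hk : (h < k.+1)%N)).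
by rewrite /= mulr0 mulr1 subr0 sub0r mulrN.
Qed.

Let last_gen_last j : last_gen j 0 (inord k.+1) = - j%:R.
Proof. by rewrite /last_gen !mxE inordK// eqxx mulr1 add0r. Qed.

(** The largest index up to [k] of a nonzero coordinate, an invariant under nonzero scaling. *)
Let gen_rank (g : zigI) : nat := if g is inl (h, _) then h.+1 else 0.

Let gen_rank_le g : (gen_rank g <= k)%N.
Proof. by case: g => [[h i]|j] //=; exact: ltn_ord. Qed.

Let gen_rank_coord g : zigzag_gen g 0 (inord (gen_rank g)) != 0.
Proof.
case: g => [[h i]|j] /=; last by rewrite last_gen_coord// oner_eq0.
rewrite zig_gen_coord// eqxx ltn_eqF// mulr1 sub0r mulf_neq0 ?oppr_eq0//.
exact: lt0r_neq0.
Qed.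

Let gen_above_rank g l : (gen_rank g < l <= k)%N -> zigzag_gen g 0 (inord l) = 0.
Proof.
case: g => [[h i]|j] /= /andP[hl lk]; last by rewrite last_gen_coord// ltn_eqF.
by rewrite zig_gen_coord// !ltn_eqF ?(ltnW hl)// mulr0 subr0 mulr0.
Qed.

Let slope_intercept_inj i j :
  slope R N i = slope R N j -> intercept R N i = intercept R N j -> i = j.
Proof.
have N0 : N%:R != 0 :> R by rewrite pnatr_eq0 -lt0n.
have N0' : 0 < N%:R :> R by rewrite ltr0n.
rewrite /slope /intercept -(signr_odd R i) -(signr_odd R j).
case: (odd i); case: (odd j) => /(mulIf N0) => /=.
- by move=> _ /eqP; rewrite eqr_nat eqn_pmul2l// => /eqP[].
- by rewrite expr1 expr0 => H; exfalso; move: H; lra.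
- by rewrite expr1 expr0 => H; exfalso; move: H; lra.
- by move=> _ /oppr_inj/eqP; rewrite eqr_nat eqn_pmul2l// => /eqP.
Qed.

Lemma gen_neq0 g : zigzag_gen g != 0.
Proof. by apply: contraNneq (gen_rank_coord g) => ->; rewrite mxE. Qed.

(** Parallel generators have equal rank, hence lie in the same block. There a common nonzero
    coordinate forces [c = 1], and the other coordinates recover the line or the level. *)
Lemma gen_not_parallel g g' (c : R) : g != g' -> zigzag_gen g != c *: zigzag_gen g'.
Proof.
move=> gg'; apply/eqP => E.
have Ec l : zigzag_gen g 0 l = c * zigzag_gen g' 0 l by rewrite E mxE.
have c0 : c != 0.
  by apply: contraNneq (gen_neq0 g) => c0; rewrite E c0 scale0r.
have [lt|lt|] := ltngtP (gen_rank g) (gen_rank g').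
- have /eqP := Ec (inord (gen_rank g')).
  rewrite gen_above_rank ?lt ?gen_rank_le// eq_sym mulf_eq0 (negPf c0).
  by rewrite (negPf (gen_rank_coord g')).
- have /eqP := Ec (inord (gen_rank g)).
  rewrite [X in _ * X]gen_above_rank ?lt ?gen_rank_le// mulr0.
  by rewrite (negPf (gen_rank_coord g)).
case: g g' gg' E Ec => [[h i]|j] [[h' i']|j'] //= gg' _ Ec; last first.
  have := Ec (inord 0); rewrite !last_gen_coord// mulr1 => c1 _.
  have := Ec (inord k.+1); rewrite !last_gen_last -c1 mul1r => /oppr_inj/eqP.
  rewrite eqr_nat => /eqP jj'; case/eqP: gg'; congr inr; exact: val_inj.
move=> [/val_inj hh']; rewrite -{h'}hh' in gg' Ec.
have W0 := lt0r_neq0 (WX_gt0 h.+1).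
have := Ec (inord h); rewrite !zig_gen_coord ?(ltnW (ltn_ord h))// eqxx.
rewrite gtn_eqF// !mulr0 subr0 mulr1 -{1}[W ^+ _]mul1r => /(mulIf W0) c1.
have := Ec (inord h.+1); rewrite !zig_gen_coord// eqxx ltn_eqF// !mulr1 !sub0r.
rewrite -c1 mul1r => /(mulfI W0)/oppr_inj sE.
have := Ec (inord k.+1); rewrite !zig_gen_last//.
rewrite -c1 mul1r => /oppr_inj/(mulfI W0) iE.
case/eqP: gg'; congr (inl (_, _)); apply: val_inj; exact: slope_intercept_inj.
Qed.

(** The levels 0 and 1 give [e 0] and [e k.+1]; since slopes are nonzero, block [h] then gives
    [e h.+1] from [e h]. *)
Lemma gen_span (V : {vspace 'rV[R]_k.+2}) : (forall g, zigzag_gen g \in V) -> V = fullv.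
Proof.
move=> gV.
have e0 : e 0 \in V.
  have := gV (inr (Ordinal (ltnW M_gt1))).
  by rewrite /= /last_gen scale0r subr0.
have es : e k.+1 \in V.
  have := gV (inr (Ordinal M_gt1)); rewrite /= /last_gen scale1r.
  by rewrite rpredBl.
have eV j : (j <= k)%N -> e j \in V.
  elim: j => [//|h IHh] hk.
  have := gV (inl (Ordinal hk, Ordinal N_gt0)).
  rewrite /= /zig_gen rpredZeq (negPf (lt0r_neq0 (WX_gt0 _)))/=.
  by rewrite rpredBr ?rpredZ// rpredBl ?IHh ?(ltnW hk)// rpredZeq (negPf (slope_neq0 _)).
apply/eqP; rewrite eqEsubv subvf; apply/subvP => x _.
rewrite (row_sum_delta x); apply: rpred_sum => j _; apply: rpredZ.
have -> : delta_mx 0 j = e j by apply/rowP => l; rewrite !mxE eqxx.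
by have := ltn_ord j; rewrite ltnS leq_eqVlt => /orP[/eqP->|/eV].
Qed.

(** * The section and its many vertices *)

Let a (i : 'I_#|{: zigI}|) : 'rV[R]_k.+2 := zigzag_gen (enum_val i).

Let zonotopeP x : zonotope_at 0 a x <->
  exists2 l : zigI -> R, forall g, -1 <= l g <= 1 & x = \sum_g l g *: zigzag_gen g.
Proof.
split=> -[l lB ->].
  exists (l \o enum_rank) => [g|]; first exact: lB.
  rewrite add0r [RHS](reindex _ (onW_bij _ (@enum_val_bij zigI))) /=.
  by apply: eq_bigr => i _; rewrite enum_valK.
exists (l \o enum_val) => [i|]; first exact: lB.
by rewrite add0r (reindex _ (onW_bij _ (@enum_val_bij zigI))).
Qed.

Let zone_vectors_gen : zone_vectors a.
Proof.
split=> [i||i j ij c]; first exact: gen_neq0.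
  apply: gen_span => g; rewrite -(enum_rankK g); apply: memv_span; exact: codom_f.
by apply: gen_not_parallel; rewrite (inj_eq enum_val_inj).
Qed.

Let U : {vspace 'rV[R]_k.+2} := <<[:: e k; e k.+1]>>%VS.

Let memU x : (x \in U) <-> forall j, (j < k)%N -> x 0 (inord j) = 0.
Proof.
rewrite /U span_cons span_seq1; split=> [/memv_addP[_ /vlineP[c ->]]|x0].
  move=> [_ /vlineP[c' ->]] -> j jk; rewrite !mxE inordK; last by lia.
  by rewrite (ltn_eqF jk) (ltn_eqF (leqW jk)) /= !mulr0n !mulr0 addr0.
apply/memv_addP; exists (x 0 (inord k) *: e k).
  by rewrite memvZ// memv_line.
exists (x 0 (inord k.+1) *: e k.+1); first by rewrite memvZ// memv_line.
apply/rowP => j; rewrite !mxE -{1}[j]inord_val.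
have : (j <= k.+1)%N := ltn_ord j.
rewrite leq_eqVlt => /orP[/eqP ->|].
  by rewrite eqxx gtn_eqF//= mulr0n mulr0 add0r mulr1.
rewrite ltnS leq_eqVlt => /orP[/eqP ->|jk].
  by rewrite eqxx ltn_eqF//= mulr0n mulr0 addr0 mulr1.
by rewrite x0// (ltn_eqF jk) (ltn_eqF (leqW jk)) /= !mulr0n !mulr0 addr0.
Qed.

Let dimU : \dim U = 2%N.
Proof.
have /eqP : free [:: e k; e k.+1]; last by [].
rewrite free_cons span_seq1 seq1_free; apply/andP; split.
  apply/vlineP => -[c /rowP/(_ (inord k))]; rewrite !mxE inordK// eqxx.
  by rewrite ltn_eqF//= mulr0n mulr0 => /eqP; rewrite oner_eq0.
apply/eqP => /rowP/(_ (inord k.+1)); rewrite !mxE inordK// eqxx => /eqP.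
by rewrite oner_eq0.
Qed.

Let L : set 'rV[R]_k.+2 := [set 0 + u | u in [set u | u \in U]].

Let P := zonotope_at 0 a `&` L.

Let sectionP x : P x <-> (exists2 l : zigI -> R, forall g, -1 <= l g <= 1 &
  x = \sum_g l g *: zigzag_gen g) /\ (forall j, (j < k)%N -> x 0 (inord j) = 0).
Proof.
rewrite -memU; split=> [[/zonotopeP Zx [u uU ux]]|[/zonotopeP Zx xU]].
  by split; rewrite // -ux add0r.
by split=> //; exists x => //; rewrite add0r.
Qed.

Let central_section : is_central_section #|{: zigI}| P.
Proof.
exists (zonotope_at 0 a), 0, L; split=> //.
- by exists 0, a; split=> //; exact: zone_vectors_gen.
- move=> x /zonotopeP[l lB ->]; apply/zonotopeP; exists (fun g => - l g).
    by move=> g; have /andP[l1 l2] := lB g; rewrite lerN2 l2 lerNl l1.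
  by rewrite mul0rn sub0r -sumrN; apply: eq_bigr => g _; rewrite scaleNr.
- by exists 0, U; split; first exact: dimU.
- by exists 0; rewrite ?addr0//=; exact: mem0v.
Qed.

(** The bound holds term by term, so equality makes every coefficient tight, and
    [address_coeff_unique] applies to points of the section. *)
Let dir_vertex b : (forall h, (b h < N)%N) -> forall l : zigI -> R,
  (forall g, -1 <= l g <= 1) ->
  let x := \sum_g l g *: zigzag_gen g in
  let v := address_vertex b in
  let u := address_dir b in
  (x *m u) 0 0 <= (v *m u) 0 0 /\
  ((forall j, (j < k)%N -> x 0 (inord j) = 0) -> (x *m u) 0 0 = (v *m u) 0 0 ->
   forall g, l g = address_coeff b g).
Proof.
move=> bN l lB x v u.
have dot (m : zigI -> R) :
    ((\sum_g m g *: zigzag_gen g) *m u) 0 0 = \sum_g m g * (zigzag_gen g *m u) 0 0.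
  by rewrite mulmx_suml summxE; apply: eq_bigr => g _; rewrite scalemx_dot.
have vE : (v *m u) 0 0 = \sum_g `|(zigzag_gen g *m u) 0 0|.
  by rewrite dot; apply: eq_bigr => g _; exact: address_coeff_tight.
have le g : l g * (zigzag_gen g *m u) 0 0 <= `|(zigzag_gen g *m u) 0 0|.
  apply: le_trans (ler_norm _) _; rewrite normrM ler_piMl//.
  by rewrite ler_norml.
rewrite vE dot; split=> [|x0 E]; first by apply: ler_sum => g _; exact: le.
apply: address_coeff_unique => // g; apply/eqP.
have : \sum_g (`|(zigzag_gen g *m u) 0 0| - l g * (zigzag_gen g *m u) 0 0) == 0.
  by rewrite sumrB E subrr.
rewrite psumr_eq0 => [/allP/(_ g)|g' _]; last by rewrite subr_ge0 le.
by rewrite mem_index_enum subr_eq0 eq_sym => /(_ isT).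
Qed.

Let section_vertex b : (forall h, (b h < N)%N) -> P (address_vertex b).
Proof.
move=> bN; apply/sectionP; split; last exact: address_vertex_coord.
by exists (address_coeff b) => // g; exact: address_coeff_bound.
Qed.

Let vertices_section b : (forall h, (b h < N)%N) -> vertices P (address_vertex b).
Proof.
move=> bN; exists (address_dir b), ((address_vertex b *m address_dir b) 0 0); split.
  by move=> x /sectionP[[l lB ->] _]; have [] := dir_vertex _ bN _ lB.
apply/seteqP; split=> [_ ->|x [/sectionP[[l lB ->] x0] E]].
  by split=> //; exact: section_vertex.
have [_ /(_ x0 E) lE] := dir_vertex _ bN _ lB.
by apply: eq_bigr => g _; rewrite lE.
Qed.

Lemma section_many_vertices : exists2 Q : set 'rV[R]_k.+2,
  is_central_section (k * N + M) Q & (`I_(N ^ k.+1) #<= vertices Q)%card.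
Proof.
exists P.
  have <- : #|{: zigI}| = (k * N + M)%N by rewrite card_sum card_prod !card_ord.
  exact: central_section.
(* Only the entries 0, ..., k of an address matter; beyond them [inord] repeats the entry 0. *)
pose b (f : {ffun 'I_k.+1 -> 'I_N}) (h : nat) : nat := f (inord h).
have bN f h : (b f h < N)%N by exact: ltn_ord.
have card_addr : #|{: {ffun 'I_k.+1 -> 'I_N}}| = (N ^ k.+1)%N.
  by rewrite card_ffun !card_ord.
rewrite -card_addr.
pose v (i : 'I_#|{: {ffun 'I_k.+1 -> 'I_N}}|) := address_vertex (b (enum_val i)).
have v_inj : injective v.
  move=> i j vij; apply: enum_val_inj; apply/ffunP => h.
  (* The coefficients of [v j] are tested against the functional of [v i]: equal points have equal
     coefficients, hence equal addresses. *)
  have [_ H] := dir_vertex _ (bN (enum_val i)) (address_coeff (b (enum_val j)))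
    (address_coeff_bound _).
  have E := H (address_vertex_coord _ (bN _)).
  rewrite -/(address_vertex _) -/(v j) -/(v i) vij in E.
  have := address_coeff_inj _ _ (bN (enum_val j)) (bN (enum_val i)) (E erefl) h.
  by rewrite -ltnS ltn_ord => /(_ isT); rewrite /b inord_val => /val_inj ->.
have /card_eqPle[II _] := @card_II #|{: {ffun 'I_k.+1 -> 'I_N}}|.
apply: (card_le_trans II).
have /card_eqPle[_ vI] : (v @` setT #= @setT 'I_#|{: {ffun 'I_k.+1 -> 'I_N}}|)%card.
  by apply: inj_card_eq => i j _ _; exact: v_inj.
apply: (card_le_trans vI); apply: subset_card_le => _ [i _ <-].
exact: vertices_section.
Qed.

End Generators.

(** * The maximum and its two estimates *)

Lemma max_section_verticesP (R : realType) (k n : nat) : (k.+2 <= n)%N ->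
  is_max_section_vertices R k.+2 n (max_section_vertices R k.+2 n).
Proof.
move=> kn; apply: (@xgetPex _ 0%N [set m | is_max_section_vertices R k.+2 n m]).
pose A m := `[< exists2 P : set 'rV[R]_k.+2,
  is_central_section n P & (vertices P #= `I_m)%card >].
have leA m : A m -> (m <= 3 * (2 * n + 1) ^ k.+1)%N.
  move=> /asboolP[P /section_vertices_le le /card_eqPle[_ ge]].
  by rewrite -card_le_II; apply: card_le_trans ge le.
have exA (P : set 'rV[R]_k.+2) : is_central_section n P ->
    exists2 m, A m & (vertices P #= `I_m)%card.
  move=> sP; have /finite_setP[m Pm] : finite_set (vertices P).
    apply/finite_set_leP; exists (3 * (2 * n + 1) ^ k.+1)%N.
    exact: (section_vertices_le _ _ _ _ sP).
  by exists m => //; apply/asboolP; exists P.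
have [m Am] : exists m, A m.
  (* The construction with [N = 1] provides some central section for every [n >= k.+2], so the set
     of attained counts is nonempty. *)
  have [||P sP _] := @section_many_vertices R k 1 (n - k) erefl; try lia.
  rewrite muln1 subnKC in sP; last by lia.
  by have [m Am _] := exA P sP; exists m.
case: (ex_maxnP (ex_intro _ m Am) leA) => {}m {}Am maxm; exists m; split.
  exact/asboolP.
move=> P /exA[m' /maxm m'm /card_eqPle[le _]].
by apply: card_le_trans le _; rewrite card_le_II.
Qed.

Lemma max_section_vertices_le (R : realType) (k n : nat) : (k.+2 <= n)%N ->
  (max_section_vertices R k.+2 n <= 3 * 3 ^ k.+1 * n ^ k.+1)%N.
Proof.
move=> kn; have [[P sP /card_eqPle[_ ge]] _] := max_section_verticesP R k n kn.
have := card_le_trans ge (section_vertices_le _ _ _ _ sP).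
rewrite card_le_II => /leq_trans; apply.
by rewrite -mulnA -expnMn leq_mul2l leq_exp2r//; lia.
Qed.

Lemma max_section_vertices_ge (R : realType) (k n : nat) : (k.+2 <= n)%N ->
  (n ^ k.+1 <= (3 * k.+1) ^ k.+1 * max_section_vertices R k.+2 n)%N.
Proof.
(* [N] is the largest odd number up to [q]; the remaining [n - k * N] zones, at least [N] of them,
   serve as last generators. *)
move=> kn; pose q := (n %/ k.+1)%N; pose N := (q.-1./2.*2).+1.
have q_gt0 : (0 < q)%N by rewrite divn_gt0//; lia.
have qn : (k.+1 * q <= n)%N by rewrite mulnC leq_trunc_div.
have nq : (n < k.+1 * q.+1)%N by rewrite mulnC ltn_ceil.
have Nq : (N <= q)%N by rewrite /N; lia.
have qN : (q <= 2 * N)%N by rewrite /N; lia.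
have oddN : odd N by rewrite /N /= odd_double.
have kNn : (k.+1 * N <= n)%N by apply: leq_trans qn; rewrite leq_mul2l Nq orbT.
have kN : (k * N <= n)%N by apply: leq_trans kNn; rewrite leq_mul2r leqnSn orbT.
have NM : (N <= n - k * N)%N by rewrite leq_subRL// -mulSnr.
have M_gt1 : (1 < n - k * N)%N.
  have [N1|N1] := leqP N 1; last exact: leq_trans NM.
  have -> : N = 1%N by lia.
  lia.
have [P sP many] := section_many_vertices R k N (n - k * N) oddN NM M_gt1.
rewrite subnKC// in sP.
have [_ /(_ P sP) le] := max_section_verticesP R k n kn.
have := card_le_trans many le; rewrite card_le_II => Nm.
apply: leq_trans (leq_mul (leqnn _) Nm); rewrite -expnMn leq_exp2r//.
(* From q <= N + 1 and N >= 1 follows q + 1 <= 3 N, so n < 3 (k + 1) N. *)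
have : (k.+1 * q.+1 <= k.+1 * (3 * N))%N by rewrite leq_mul2l; apply/orP; right; lia.
lia.
Qed.

Theorem theorem1p2 (R : realType) (d : nat) (hd : (2 <= d)%N) :
  (forall n : nat, (d <= n)%N ->
     is_max_section_vertices R d n (max_section_vertices R d n)) /\
  (fun n : nat => (max_section_vertices R d n)%:R : R^o)
    \is 'Theta_\oo (fun n : nat => (n%:R ^+ (d - 1) : R^o)).
Proof.
case: d hd => [|[|k]] // _; split=> [n|]; first exact: max_section_verticesP.
rewrite qualifE; apply/asboolP.
exists ((((3 * k.+1) ^ k.+1)%N%:R)^-1 : R, (3 * 3 ^ k.+1)%N%:R : R) => /=.
  by rewrite invr_gt0 !ltr0n muln_gt0 !expn_gt0.
apply: filterS (nbhs_infty_ge k.+2) => n kn.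
rewrite subn1 /= -natrX !normr_nat; split.
  rewrite ler_pdivrMl ?ltr0n ?expn_gt0//.
  by rewrite -natrM ler_nat max_section_vertices_ge.
by rewrite -natrM ler_nat max_section_vertices_le.
Qed.
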